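(* Let $G$ be a connected graph and let $G'$ be a graph obtained by identifying a vertex of $G$ and a vertex of the complete graph $K_n$ on $n$ vertices (taken disjoint from $G$). If $G$ is $(2,2)$-choosable, then $G'$ is $(2,2)$-choosable.
   Context: Graphs are finite and simple. A total-weighting of $G=(V,E)$ is a mapping $f:V\cup E\to\mathbb{R}$. For $v\in V$ put $s(v)=f(v)+\sum_{e\in E(v)}f(e)$, where $E(v)$ is the set of edges incident with $v$. The total-weighting $f$ is proper if $s(u)\neq s(v)$ for any two adjacent vertices $u,v$. The graph $G$ is $(k,k')$-choosable if for every assignment $L$ of a set $L(v)$ of $k$ real numbers to each vertex $v$ and a set $L(e)$ of $k'$ real numbers to each edge $e$, there is a proper total-weighting $f$ with $f(z)\in L(z)$ for all $z\in V\cup E$. *)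

(* Defs.v *)
From mathcomp Require Import all_boot all_order all_algebra.
From mathcomp Require Import finmap reals.

Set Implicit Arguments.
Unset Strict Implicit.
Unset Printing Implicit Defensive.

Import GRing.Theory.
Local Open Scope ring_scope.

Record sgraph := SGraph {
  vertex :> finType;
  adj : rel vertex;
  adj_sym : symmetric adj;
  adj_irrefl : irreflexive adj }.

Definition connected_graph (G : sgraph) : Prop :=
  forall x y : G, connect (@adj G) x y.

Definition edges (G : sgraph) : {set {set G}} :=
  [set [set x; y] | x in G, y in G & adj x y].

Definition edge (G : sgraph) : finType := {e : {set G} | e \in edges G}.

Fact neq_sym (T : finType) : symmetric (fun x y : T => x != y).
Proof. by move=> x y; rewrite eq_sym. Qed.

Fact neq_irrefl (T : finType) : irreflexive (fun x y : T => x != y).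
Proof. by move=> x; rewrite eqxx. Qed.

Definition complete_graph (n : nat) : sgraph :=
  SGraph (@neq_sym 'I_n) (@neq_irrefl 'I_n).

Section Weighting.
Variables (R : realType) (G : sgraph).

Definition total_weighting := (G + edge G)%type -> R.

Definition vertex_sum (f : total_weighting) (v : G) : R :=
  f (inl v) + \sum_(e : edge G | v \in val e) f (inr e).

Definition proper_weighting (f : total_weighting) : Prop :=
  forall u v : G, adj u v -> vertex_sum f u != vertex_sum f v.

Definition choosable (k k' : nat) : Prop :=
  forall L : (G + edge G)%type -> {fset R},
    (forall v : G, #|` L (inl v)|%fset = k) ->
    (forall e : edge G, #|` L (inr e)|%fset = k') ->
    exists f : total_weighting,
      (forall z, f z \in L z) /\ proper_weighting f.

End Weighting.

Definition disjoint_adj (G H : sgraph) (a b : G + H) : bool :=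
  match a, b with
  | inl x, inl y => adj x y
  | inr x, inr y => adj x y
  | _, _ => false
  end.

(* G' is, up to isomorphism, the quotient of the disjoint union of G and H by
   the equivalence relation whose only nontrivial class is {u, w}; p is the
   projection. *)
Definition vertex_identification (G H : sgraph) (u : G) (w : H)
    (G' : sgraph) : Prop :=
  exists p : (G + H)%type -> G',
    [/\ forall c : G', exists a, p a = c,
        forall a b, p a = p b <->
          [\/ a = b, a = inl u /\ b = inr w | a = inr w /\ b = inl u]
      & forall c d : G', adj c d <->
          exists a b, [/\ p a = c, p b = d & disjoint_adj a b]].

(* Main.v *)
Require Import Defs.
From mathcomp Require Import all_boot all_order all_algebra.
From mathcomp Require Import finmap boolp reals.

Set Implicit Arguments.
Unset Strict Implicit.
Unset Printing Implicit Defensive.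

Import Order.TTheory GRing.Theory Num.Theory.
Local Open Scope ring_scope.

(** The theorem is true because, once the edges of a clique K + u have been
weighted well, the vertices of K can still react to whatever sum u receives.

Each vertex v of K has a list {lo v < hi v}.  If the edges of K + u are weighted
so that the sums computed with the values lo v are pairwise distinct on K, then
for every real t the vertices of K have values in their lists that give pairwise
distinct sums, all different from t ([avoiding_choice]): going up from the
smallest sum, a vertex whose low sum is forbidden takes its high one, which
becomes the value that the vertices above it have to avoid.

Such a weighting of the edges exists because, when the values lo v are held
fixed, the edge uv contributes to the sum of v and to no other sum in K; so it
plays the part of a vertex weight of v, and what is required is that K with
lists of size two on its vertices and edges have a weighting with distinct sums
([clique_extension]).  That is the case by induction on the size of the clique:
the induction step from K to K + u is the statement above, taking for t the sum
of u under an arbitrary choice of its own weight ([cliques_are_choosable]).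

Now glue K + u to G at u.  Weight the edges of K + u first, with total c at u,
then weight G properly after translating the list of u by c, and finally weight
the vertices of K so as to avoid the sum obtained at u
([choosable_glue_clique]). *)

(** * Distinct values avoiding a given one *)

Lemma two_values (R : realDomainType) (X : {fset R}) :
  #|` X|%fset = 2%N -> exists ab : R * R,
    [/\ ab.1 < ab.2, ab.1 \in X & ab.2 \in X].
Proof.
move=> X2; have /fset0Pn [a aX] : X != fset0 by rewrite -cardfs_eq0 X2.
have /fset0Pn [b] : (X `\ a)%fset != fset0.
  by rewrite -cardfs_eq0; move: (cardfsD1 a X); rewrite X2 aX add1n => -[<-].
rewrite !inE => /andP[nba bX].
by case: (ltgtP a b) nba => // ab _; [exists (a, b) | exists (b, a)].
Qed.

(** Joining lo v to hi v for each v in A gives a forest on the reals: the least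
point of a cycle would be the lower end of two of these edges.  Rooting its trees,
with t among the roots, gives each edge an endpoint of its own other than t.  The
induction removes the vertex with the least lo.  If its lo is not t, it takes lo,
which is below all values of the other vertices; if its lo is t, it takes hi, the
others are made to avoid hi, and they avoid t because their values exceed it. *)
Lemma avoiding_choice (R : realDomainType) (T : finType) (A : {set T})
    (lo hi : T -> R) (t : R) :
  {in A, forall v, lo v < hi v} -> {in A &, injective lo} ->
  exists x : T -> R,
    [/\ {in A, forall v, x v = lo v \/ x v = hi v},
        {in A &, injective x} & {in A, forall v, x v != t}].
Proof.
move: {2}#|A| (leqnn #|A|) => n; elim: n A t => [|n IH] A t.
  rewrite leqn0 cards_eq0 => /eqP-> _ _; exists lo.
  by split=> v; rewrite inE.
move=> cardA lohi injlo; case: (set_0Vmem A) => [A0|[v1 v1A]].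
  by exists lo; rewrite A0; split=> v; rewrite inE.
case: (arg_minP lo v1A) => v0 v0A' lo_min.
have v0A : v0 \in A by [].
pose hit := lo v0 == t; pose c := if hit then hi v0 else lo v0.
have [|v|v w|x [xP xI xt]] := IH (A :\ v0) (if hit then hi v0 else t).
- by move: cardA; rewrite (cardsD1 v0 A) v0A.
- by move=> /setD1P[_ /lohi].
- by move=> /setD1P[_ vA] /setD1P[_ wA]; apply: injlo.
have x_gt v : v \in A -> v != v0 -> lo v0 < x v.
  move=> vA nv; have lo_lt : lo v0 < lo v.
    rewrite lt_neqAle lo_min // andbT.
    by apply: contra_neq nv => /injlo ->.
  have vA' : v \in A :\ v0 by rewrite !inE nv.
  by have [->|->] := xP v vA' => //; apply: lt_trans (lohi v vA).
have x_nc v : v \in A -> v != v0 -> x v != c /\ x v != t.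
  move=> vA nv; have vA' : v \in A :\ v0 by rewrite !inE nv.
  have := xt v vA'; have := x_gt v vA nv; rewrite /c /hit.
  by case: (eqVneq (lo v0) t) => [<-|_] xgt xne; split=> //; rewrite gt_eqF.
exists (fun v => if v == v0 then c else x v); split=> [v vA|v w vA wA|v vA].
- case: eqVneq => [->|nv]; first by rewrite /c; case: (hit); [right|left].
  by apply: xP; rewrite !inE nv.
- case: (eqVneq v v0) => [->|nv]; case: (eqVneq w v0) => [->|nw] //.
  + by move=> cE; have [] := x_nc w wA nw; rewrite -cE eqxx.
  + by move=> cE; have [] := x_nc v vA nv; rewrite cE eqxx.
  + by apply: xI; rewrite !inE ?nv ?nw.
- case: (eqVneq v v0) => [_|nv]; last by case: (x_nc v vA nv).
  rewrite /c /hit; case: (eqVneq (lo v0) t) => [<-|//].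
  by rewrite gt_eqF // lohi.
Qed.

(** * Weighting cliques *)

(** The part of the vertex sum of v that comes from the edges of the clique on
A; edges are encoded as two-element sets, so that symmetry is built in. *)
Definition clique_sum (R : realDomainType) (T : finType) (A : {set T})
    (y : {set T} -> R) (v : T) : R :=
  \sum_(w in A :\ v) y [set v; w].

(** (2,2)-choosability of the complete graph on A, with A kept as a subset of an
ambient type so that the induction can remove a vertex from it. *)
Definition clique_choosable (R : realDomainType) (T : finType) (A : {set T}) :=
  forall (P : T -> {fset R}) (Q : {set T} -> {fset R}),
    {in A, forall v, #|` P v|%fset = 2%N} ->
    {in A &, forall v w, v != w -> #|` Q [set v; w]|%fset = 2%N} ->
    exists x y,
    [/\ {in A, forall v, x v \in P v},
        {in A &, forall v w, v != w -> y [set v; w] \in Q [set v; w]} &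
        {in A &, injective (fun v => x v + clique_sum A y v)}].

Definition shift (R : realDomainType) (c : R) (X : {fset R}) : {fset R} :=
  [fset (c + x)%R | x in X]%fset.

Lemma card_shift (R : realDomainType) c (X : {fset R}) :
  #|` shift c X|%fset = #|` X|%fset.
Proof. by apply: card_imfset; apply: addrI. Qed.

Lemma mem_shift (R : realDomainType) c (X : {fset R}) z :
  (z \in shift c X) = (z - c \in X).
Proof.
apply/imfsetP/idP => [[x xX ->]|zX]; first by rewrite addrC addKr.
by exists (z - c) => //; rewrite addrC subrK.
Qed.


Lemma clique_sumU1 (R : realDomainType) (T : finType) (A : {set T}) u v
    (y : {set T} -> R) : u \notin A -> v \in A ->
  clique_sum (u |: A) y v = y [set u; v] + clique_sum A y v.
Proof.
move=> uA vA; have uv : u != v by apply: contraNneq uA => ->.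
rewrite /clique_sum (big_setD1 u) /=; last by rewrite !inE uv eqxx.
rewrite [[set v; u]]setUC; congr (_ + _); apply: eq_bigl => w.
by rewrite !inE; case: eqVneq => // ->; rewrite (negPf uA) andbF.
Qed.

(** The weight y of the edges is chosen before t is known.  This order of
quantifiers matters for the gluing, where the sum at u depends on the edges at u
in a way that is not controlled. The edge weights come from the choosability
of the clique on A, where v receives as its vertex list the list of the edge uv
translated by the smaller element of its own list. *)
Lemma clique_extension (R : realDomainType) (T : finType) (A : {set T}) (u : T)
    (P : T -> {fset R}) (Q : {set T} -> {fset R}) :
  u \notin A -> clique_choosable R A ->
  {in A, forall v, #|` P v|%fset = 2%N} ->
  {in u |: A &, forall v w, v != w -> #|` Q [set v; w]|%fset = 2%N} ->
  exists2 y, {in u |: A &, forall v w, v != w -> y [set v; w] \in Q [set v; w]}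
  & forall t, exists x,
    [/\ {in A, forall v, x v \in P v},
        {in A &, injective (fun v => x v + clique_sum (u |: A) y v)} &
        {in A, forall v, x v + clique_sum (u |: A) y v != t}].
Proof.
move=> uA chA P2 Q2.
have [] := @choice T (R * R)%type (fun v ab => v \in A ->
    [/\ ab.1 < ab.2, ab.1 \in P v & ab.2 \in P v]).
  move=> v; have [/P2/two_values[ab abP]|] := boolP (v \in A).
    by exists ab.
  by exists (0, 0).
move=> ab abP; pose lo v := (ab v).1; pose hi v := (ab v).2.
have [|v w vA wA|z [y0 [zP y0Q z_inj]]] :=
    chA (fun v => shift (lo v) (Q [set u; v])) Q.
- move=> v vA; rewrite card_shift Q2 ?setU11 ?setU1r //.
  by apply: contraNneq uA => ->.
- by apply: Q2; rewrite setU1r.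
(* For e = {u, v} the sum has the single term v, and y e is the value of the
   list of uv that the weight z v of v stands for. *)
pose y (e : {set T}) :=
  if u \in e then \sum_(v in e :\ u) (z v - lo v)
  else y0 e.
have y_u v : v \in A -> y [set u; v] = z v - lo v.
  move=> vA; rewrite /y set21 setU1K ?big_set1 // inE.
  by apply: contraNneq uA => ->.
have y_A v w : v \in A -> w \in A -> y [set v; w] = y0 [set v; w].
  move=> vA wA; rewrite /y !inE ifN // negb_or.
  by apply/andP; split; apply: contraNneq uA => ->.
pose s v := clique_sum (u |: A) y v.
have lo_s v : v \in A -> lo v + s v = z v + clique_sum A y0 v.
  move=> vA; rewrite /s clique_sumU1 // y_u // addrA (addrC (lo v)) subrK.
  congr (_ + _); apply: eq_bigr => w /setD1P[_ wA]; exact: y_A.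
exists y => [v w|t].
  have uQ v' : v' \in A -> y [set u; v'] \in Q [set u; v'].
    by move=> vA; rewrite y_u // -mem_shift zP.
  case/setU1P=> [->|vA]; case/setU1P=> [->|wA]; rewrite ?eqxx // => vw.
  - exact: uQ.
  - by rewrite setUC uQ.
  - by rewrite y_A // y0Q.
have [|v w vA wA|x [xP x_inj xt]] :=
    @avoiding_choice R T A (fun v => lo v + s v) (fun v => hi v + s v) t.
- by move=> v /abP[lohi _ _]; rewrite ltrD2r.
- by rewrite !lo_s //; apply: z_inj.
exists (fun v => x v - s v); split=> [v vA|v w vA wA|v vA]; rewrite ?subrK.
- by have [_ ? ?] := abP v vA; have [->|->] := xP v vA; rewrite addrK.
- exact: x_inj.
- exact: xt.
Qed.

Lemma cliques_are_choosable (R : realDomainType) (T : finType) (A : {set T}) :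
  clique_choosable R A.
Proof.
move: {2}#|A| (leqnn #|A|) => n; elim: n A => [|n IH] A.
  rewrite leqn0 cards_eq0 => /eqP-> P Q _ _; exists (fun=> 0), (fun=> 0).
  by split=> v; rewrite inE.
move=> cardA; case: (set_0Vmem A) => [A0|[u uA]].
  by apply: IH; rewrite A0 cards0.
rewrite -(setD1K uA) in cardA *; move: (A :\ u) (setD11 u A) cardA => B.
move=> /negbT uB; rewrite cardsU1 uB ltnS => /IH chB P Q P2 Q2.
have [|y yQ yx] := @clique_extension R T B u P Q uB chB _ Q2.
  by move=> v vB; apply: P2; rewrite setU1r.
have /fset0Pn[a aP] : P u != fset0 by rewrite -cardfs_eq0 P2 ?setU11.
have [x [xP x_inj xt]] := yx (a + clique_sum (u |: B) y u).
have nu v : v \in B -> (v == u) = false.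
  by move=> vB; apply: contraNF uB => /eqP <-.
exists (fun v => if v == u then a else x v), y; split=> //.
  by move=> v /setU1P[->|vB]; [rewrite eqxx | rewrite nu // xP].
move=> v w /setU1P[->|vB] /setU1P[->|wB]; rewrite ?eqxx ?nu //.
- by move=> /esym/eqP; rewrite (negPf (xt w wB)).
- by move=> /eqP; rewrite (negPf (xt v vB)).
- exact: x_inj.
Qed.

(** * Gluing a clique at a vertex *)

Lemma edge_adj (G : sgraph) (e : edge G) :
  exists v w, adj v w /\ val e = [set v; w].
Proof.
by case: e => e /= /imset2P[v w _]; rewrite inE => vw ->; exists v, w.
Qed.

Lemma adj_edge (G : sgraph) (v w : G) :
  adj v w -> exists e : edge G, val e = [set v; w].
Proof.
move=> vw; have vwE : [set v; w] \in edges G.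
  by apply/imset2P; exists v w; rewrite ?inE.
by exists (exist (fun e => e \in edges G) _ vwE).
Qed.

Lemma vertex_sumE (R : realType) (G : sgraph) (F : {set G} -> R) (v : G) :
  \sum_(e : edge G | v \in val e) F (val e) = \sum_(w | adj v w) F [set v; w].
Proof.
rewrite -(big_sub_cond (mem (edges G)) (fun e : {set G} => v \in e) F).
rewrite -(@big_imset _ _ _ _ _ (fun w : G => [set v; w]) (adj v) F).
  apply: eq_bigl => e; apply/andP/imsetP => [[/imset2P[x y _]]|[w vw ->]].
    rewrite inE => xy -> /set2P[]->; first by exists y.
    by exists x; [rewrite adj_sym in xy | rewrite setUC].
  rewrite set21; split=> //; apply/imset2P; exists v w => //.
  by rewrite inE.
move=> w w' vw vw' /= /setP/(_ w); rewrite !inE eqxx orbT.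
have: w != v by apply: contraTneq vw => ->; apply/negbT/adj_irrefl.
by move=> /negPf -> /esym/eqP.
Qed.

(** Here iota embeds G as the complement of A, and the edges leaving the copy of
G are those joining A to iota u.  The edges of A + iota u are weighted first;
their total c at iota u is put into the list of u before the choosability of G
is used, so the sum of u in G is already its sum in G', and [clique_extension]
makes A avoid it. *)
Lemma choosable_glue_clique (R : realType) (G G' : sgraph) (iota : G -> G')
    (u : G) (A : {set G'}) :
  injective iota -> (forall z, (z \in A) = (z \notin codom iota)) ->
  (forall x y, adj (iota x) (iota y) = adj x y) ->
  {in A &, forall v w, adj v w = (v != w)} ->
  {in A, forall v x, adj v (iota x) = (x == u)} ->
  choosable R G 2 2 -> choosable R G' 2 2.
Proof.
move=> iota_inj AE adjG adjA adjAG chG L L2v L2e.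
have iotaA x : (iota x \in A) = false by rewrite AE codom_f.
pose Q (e : {set G'}) := if insub e is Some e' then L (inr e') else fset0.
have QE (e : edge G') : Q (val e) = L (inr e) by rewrite /Q valK.
have Q2 v w : adj v w -> #|` Q [set v; w]|%fset = 2%N.
  by move=> /adj_edge[e <-]; rewrite QE L2e.
have adjUA : {in iota u |: A &, forall v w, adj v w = (v != w)}.
  have adjuA v : v \in A -> adj v (iota u) = (v != iota u).
    move=> vA; rewrite adjAG // eqxx.
    by apply/esym; apply: contraTneq vA => ->; rewrite iotaA.
  move=> v w /setU1P[->|vA] /setU1P[->|wA]; last exact: adjA.
  - by rewrite adj_irrefl eqxx.
  - by rewrite adj_sym eq_sym adjuA.
  - exact: adjuA.
have [||v w vA wA vw|y yQ yx] := @clique_extension R G' A (iota u)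
    (fun v => L (inl v)) Q _ (@cliques_are_choosable _ _ A).
- by rewrite iotaA.
- by move=> v _; apply: L2v.
- by apply: Q2; rewrite adjUA.
pose c := clique_sum (iota u |: A) y (iota u).
have imset2E (x z : G) : iota @: [set x; z] = [set iota x; iota z].
  by rewrite imsetU !imset_set1.
have [||g [gL g_proper]] := chG (fun z => match z with
    | inl x => if x == u then shift c (L (inl (iota x))) else L (inl (iota x))
    | inr e => Q (iota @: val e)
    end).
- by move=> x; case: ifP => _; rewrite ?card_shift L2v.
- move=> e; have [x [z [xz ->]]] := edge_adj e.
  by rewrite imset2E Q2 // adjG.
(* Weights of edges are extended to all sets of vertices: this gives access to
   [vertex_sumE], and spares transporting membership proofs along iota. *)
pose gE (e : {set G}) := if insub e is Some e' then g (inr e') else 0.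
have gEE (e : edge G) : gE (val e) = g (inr e) by rewrite /gE valK.
pose F (e : {set G'}) :=
  if e \subset ~: A then gE (iota @^-1: e) else y e.
have F_G x z : F [set iota x; iota z] = gE [set x; z].
  rewrite /F subUset !sub1set !inE !iotaA /= -imset2E; congr gE.
  by apply/setP => t; rewrite inE mem_imset.
have F_A v w : v \in A -> F [set v; w] = y [set v; w].
  by move=> vA; rewrite /F subUset sub1set inE vA.
have [x [xP x_inj xt]] := yx (vertex_sum g u).
pose pre z := odflt u [pick t | iota t == z].
have preK t : pre (iota t) = t.
  by rewrite /pre; case: pickP => [t' /eqP/iota_inj|/(_ t)]; rewrite ?eqxx.
pose f (z : G' + edge G') := match z with
  | inl v => if v \in A then x v
             else if v == iota u then g (inl u) - c else g (inl (pre v))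
  | inr e => F (val e)
  end.
have f_sum v : vertex_sum f v = f (inl v) + \sum_(w | adj v w) F [set v; w].
  by rewrite -vertex_sumE.
have g_sum v : vertex_sum g v = g (inl v) + \sum_(w | adj v w) gE [set v; w].
  by rewrite -vertex_sumE; congr (_ + _); apply: eq_bigr => e _; rewrite gEE.
have f_A v : v \in A -> vertex_sum f v = x v + clique_sum (iota u |: A) y v.
  move=> vA; rewrite f_sum /f vA; congr (_ + _); apply: eq_big => [w|w _].
    rewrite !inE; have [wA|] := boolP (w \in A).
      by rewrite orbT andbT adjA // eq_sym.
    rewrite AE negbK orbF => /codomP[z ->]; rewrite adjAG // inj_eq //.
    by rewrite andb_idl // => _; apply: contraTneq vA => <-; rewrite iotaA.
  exact: F_A.
have f_G z : vertex_sum f (iota z) = vertex_sum g z.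
  rewrite f_sum g_sum (bigID (mem A)) /= addrA; congr (_ + _); last first.
    rewrite -(eq_bigr _ (fun w _ => F_G z w)).
    rewrite -(@big_imset _ _ _ _ _ iota (adj z) (fun w => F [set iota z; w])).
      apply: eq_bigl => w; apply/andP/imsetP => [[zw]|[t zt ->]].
        by rewrite AE negbK => /codomP[t wE]; exists t;
            rewrite // wE adjG in zw.
      by rewrite iotaA adjG.
    by move=> ? ? _ _; apply: iota_inj.
  rewrite /f iotaA inj_eq // preK; case: eqVneq => [->|zu].
    rewrite -[RHS](subrK c) /c /clique_sum setU1K ?iotaA //; congr (_ + _).
    apply: eq_big => [w|w /andP[_ wA]]; last by rewrite setUC F_A // setUC.
    by rewrite andb_idl // => wA; rewrite adj_sym adjAG.
  rewrite big1 ?addr0 // => w /andP[zw wA].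
  by move: zw; rewrite adj_sym adjAG // (negPf zu).
exists f; split=> [[v|e]|v w vw].
- rewrite /f; have [vA|] := boolP (v \in A); first exact: xP.
  rewrite AE negbK => /codomP[z ->]; rewrite inj_eq // preK.
  by have := gL (inl z); case: eqVneq => // ->; rewrite mem_shift.
- rewrite -QE /f; have [v [w [vw ->]]] := edge_adj e.
  have [vA|] := boolP (v \in A).
    have [wA|] := boolP (w \in A).
      by rewrite F_A // yQ ?setU1r // -adjA.
    rewrite AE negbK => /codomP[z wz]; move: vw; rewrite wz adjAG // => /eqP->.
    by rewrite F_A // yQ ?setU11 ?setU1r // -adjUA ?setU11 ?setU1r // adjAG.
  rewrite AE negbK => /codomP[z vz].
  have [wA|] := boolP (w \in A).
    move: vw; rewrite vz adj_sym adjAG // => /eqP->; rewrite setUC.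
    by rewrite F_A // yQ ?setU11 ?setU1r // -adjUA ?setU11 ?setU1r // adjAG.
  rewrite AE negbK => /codomP[t wt]; move: vw.
  rewrite vz wt adjG F_G => /adj_edge[d dE].
  by rewrite -imset2E -dE gEE; apply: gL.
have [vA|] := boolP (v \in A); have [wA|] := boolP (w \in A).
- rewrite !f_A //; apply: contraTneq vw => /x_inj-> //; exact/negbT/adj_irrefl.
- rewrite AE negbK => /codomP[z wz]; move: vw; rewrite wz adjAG // => /eqP->.
  by rewrite f_A // f_G xt.
- rewrite AE negbK => /codomP[z vz]; move: vw.
  by rewrite vz adj_sym adjAG // => /eqP->; rewrite (f_A w) // f_G eq_sym xt.
- rewrite !AE !negbK => /codomP[t wt] /codomP[z vz].
  by move: vw; rewrite vz wt adjG !f_G => /g_proper.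
Qed.

Theorem theorem4p3 (R : realType) (G : sgraph) (n : nat) (u : G)
    (w : complete_graph n) (G' : sgraph) :
  connected_graph G ->
  vertex_identification u w G' ->
  choosable R G 2 2 ->
  choosable R G' 2 2.
Proof.
move=> _ [p [p_surj p_eq p_adj]].
have p_inl x y : p (inl x) = p (inl y) -> x = y.
  by move=> /p_eq[[]|[_]|[]].
have p_mix x i : p (inl x) = p (inr i) -> x = u /\ i = w.
  by move=> /p_eq[//|[[->] [->]]|[]].
have p_uw : p (inl u) = p (inr w) by apply/p_eq; apply: Or32.
pose A := [set p (inr i) | i : complete_graph n & i != w].
apply: (@choosable_glue_clique R G G' (fun x => p (inl x)) u A) => [||x y||].
- exact: p_inl.
- move=> z; apply/imsetP/idP => [[i]|].
    rewrite inE => iw ->; apply: contraNN iw => /codomP[x /esym/p_mix[_ ->]].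
    exact: eqxx.
  have [[x|i] <-] := p_surj z; first by rewrite codom_f.
  have [->|iw _] := eqVneq i w; last by exists i; rewrite // inE.
  by rewrite -p_uw codom_f.
- apply/idP/idP => [/p_adj[a [b []]]|xy]; last first.
    by apply/p_adj; exists (inl x), (inl y).
  case: a b => [a|a] [b|b] //= pa pb.
    by rewrite (p_inl _ _ pa) (p_inl _ _ pb).
  have [_ ->] := p_mix _ _ (esym pa); have [_ ->] := p_mix _ _ (esym pb).
  by rewrite eqxx.
- move=> _ _ /imsetP[i iw ->] /imsetP[j jw ->]; rewrite !inE in iw jw.
  apply/idP/idP => [|ij].
    by apply: contraTneq => ->; apply/negbT/adj_irrefl.
  apply/p_adj; exists (inr i), (inr j); split=> //=.
  by apply: contraNneq ij => ->.
- move=> _ /imsetP[i iw ->] x; rewrite inE in iw.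
  apply/idP/eqP => [/p_adj[a [b []]]|->].
    case: a b => [a|a] [b|b] //= pa pb.
      by have [_ iwE] := p_mix _ _ pa; rewrite iwE eqxx in iw.
    by have [] := p_mix _ _ (esym pb).
  by rewrite p_uw; apply/p_adj; exists (inr i), (inr w).
Qed.
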